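(* For all Noetherian spaces $X$ and $Y$, $||X +_{\mathrm{lex}} Y|| = ||X|| + ||Y||$.
   Context: A topological space is Noetherian if every open subset is compact (every open cover has a finite subcover; no separation is required). The lexicographic sum $X +_{\mathrm{lex}} Y$ of two topological spaces is the disjoint union of $X$ and $Y$, whose open subsets are the open subsets of $Y$, plus the sets of the form $U + Y$ (disjoint union of $U$ and $Y$), where $U$ is an open subset of $X$. It is Noetherian when $X$ and $Y$ are. On the right-hand side of the claim, $+$ is ordinary ordinal addition. For a well-founded poset $P$ and $x \in P$, $\mathrm{rk}_P(x) = \sup_{x' < x} (\mathrm{rk}_P(x')+1)$ and the ordinal rank of $P$ is $|P| = \sup_{x \in P} (\mathrm{rk}_P(x)+1)$, where $\sup\emptyset = 0$. $\mathcal{H}_0 X$ is the poset of all closed subsets of $X$ (including $\emptyset$), ordered by inclusion; it is well-founded when $X$ is Noetherian. The stature of a Noetherian space $X$ is $||X|| = |\mathcal{H}_0 X| - 1$, equivalently $||X|| = \mathrm{rk}_{\mathcal{H}_0 X}(X)$. *)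

(* Defs.v *)
From HB Require Import structures.
From mathcomp Require Import all_boot all_order finmap.
From mathcomp Require Import mathcomp_extra boolp classical_sets functions.
From mathcomp Require Import cardinality topology.

Set Implicit Arguments.
Unset Strict Implicit.
Unset Printing Implicit Defensive.

Import Order.TTheory.
Local Open Scope classical_set_scope.

(* Ordinals are represented by well-founded trees: [Olim f] denotes the least
   ordinal strictly above all the [f a].  Distinct trees can denote the same
   ordinal, so equality of ordinals is [ord_eq], not Leibniz equality. *)
Inductive Ord : Type := Olim (A : Type) (f : A -> Ord).

Definition ord_index (a : Ord) : Type := let: Olim A _ := a in A.

Definition ord_child (a : Ord) : ord_index a -> Ord :=
  let: Olim _ f := a in f.

Fixpoint ord_le (a b : Ord) : Prop :=
  match a, b with Olim A f, Olim B g => forall i, exists j, ord_le (f i) (g j) end.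

Definition ord_lt (a b : Ord) : Prop :=
  exists j : ord_index b, ord_le a (ord_child j).

Definition ord_eq (a b : Ord) : Prop := ord_le a b /\ ord_le b a.

Definition ord_zero : Ord := Olim (fun v : void => match v with end).

Definition ord_succ (a : Ord) : Ord := Olim (fun _ : unit => a).

(* The (non-strict) least upper bound of a family. *)
Definition ord_sup (A : Type) (f : A -> Ord) : Ord :=
  Olim (fun p : {i : A & ord_index (f i)} => ord_child (projT2 p)).

Arguments ord_sup : simpl never.

(* The supremum of the ordinals below [a], i.e. the ordinal [a - 1] when [a]
   is a successor. *)
Definition ord_pred (a : Ord) : Ord := ord_sup (@ord_child a).

(* a + b = sup ({a} U {(a + b') + 1 | b' < b}). *)
Fixpoint ord_add (a b : Ord) : Ord :=
  match b with Olim B g =>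
    ord_sup (fun o : option B =>
      match o with None => a | Some j => ord_succ (ord_add a (g j)) end)
  end.

Lemma ord_leP a b : ord_le a b <-> forall i : ord_index a, ord_lt (ord_child i) b.
Proof. by case: a b => A f [B g]. Qed.

Lemma ord_le_refl a : ord_le a a.
Proof. by elim: a => A f ih /= i; exists i. Qed.

Lemma ord_le_trans b a c : ord_le a b -> ord_le b c -> ord_le a c.
Proof.
elim: a b c => A f ih [B g] [C h] /= ab bc i.
have [j /ih le_ij] := ab i; have [k /le_ij le_ik] := bc j.
by exists k.
Qed.

Lemma ord_lt_le_trans b a c : ord_lt a b -> ord_le b c -> ord_lt a c.
Proof.
move=> [j abj] /ord_leP/(_ j)[k bck]; exists k; exact: ord_le_trans bck.
Qed.

Lemma ord_le_lt_trans b a c : ord_le a b -> ord_lt b c -> ord_lt a c.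
Proof. by move=> ab [j bcj]; exists j; exact: ord_le_trans bcj. Qed.

Lemma ord_child_lt a (i : ord_index a) : ord_lt (ord_child i) a.
Proof. by exists i; exact: ord_le_refl. Qed.

Lemma ord_lt_le a b : ord_lt a b -> ord_le a b.
Proof.
elim: a b => A f ih b [j /ord_leP abj]; apply/ord_leP => i.
by exists j; apply: ih; exact: abj.
Qed.

Lemma ord_lt_wf : well_founded ord_lt.
Proof.
move=> a; suff H b : ord_le b a -> Acc ord_lt b by apply: H; exact: ord_le_refl.
elim: a b => A f ih b ba; constructor => c cb.
by have [i /ih] := ord_lt_le_trans cb ba.
Qed.

Lemma ord_lt_irr a : ~ ord_lt a a.
Proof. by elim/(well_founded_ind ord_lt_wf): a => a ih aa; exact: (ih a aa). Qed.

Lemma ord_leNgt a b : ord_le a b <-> ~ ord_lt b a.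
Proof.
split=> [ab ba|]; first exact: (ord_lt_irr (ord_le_lt_trans ab ba)).
elim: a b => A f ih b nba; apply/ord_leP => i.
apply: contrapT => nib; apply: nba; exists i => /=.
apply/ord_leP => j; apply: contrapT => nji; apply: nib.
by exists j; exact: ih.
Qed.

Lemma ord_le_total a b : ord_le a b \/ ord_le b a.
Proof.
by have [/ord_lt_le|/ord_leNgt] := pselect (ord_lt a b); [left|right].
Qed.

Lemma ord_zero_le a : ord_le ord_zero a.
Proof. by apply/ord_leP => -[]. Qed.

Lemma ord_succ_le a b : ord_le (ord_succ a) b <-> ord_lt a b.
Proof. by rewrite ord_leP; split=> [/(_ tt)|]. Qed.

Lemma ord_sup_le (A : Type) (f : A -> Ord) b :
  ord_le (ord_sup f) b <-> forall i, ord_le (f i) b.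
Proof.
rewrite ord_leP; split=> [H i|H [i j]].
  by apply/ord_leP => j; exact: (H (existT _ i j)).
exact: (iffLR (ord_leP _ _) (H i)).
Qed.

Lemma ord_le_sup (A : Type) (f : A -> Ord) i : ord_le (f i) (ord_sup f).
Proof. by move: i; apply/ord_sup_le; exact: ord_le_refl. Qed.

Lemma ord_pred_succ a : ord_eq (ord_pred (ord_succ a)) a.
Proof.
split; first by apply/ord_sup_le => -[]; exact: ord_le_refl.
exact: (@ord_le_sup _ (@ord_child (ord_succ a)) tt).
Qed.

Lemma ord_add_le a b c :
  ord_le (ord_add a b) c <->
  ord_le a c /\ forall j : ord_index b, ord_lt (ord_add a (ord_child j)) c.
Proof.
case: b => B g /=; split=> [/ord_sup_le H|[ac H]]; last apply/ord_sup_le.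
  by split=> [|j]; [exact: (H None)|apply/ord_succ_le; exact: (H (Some j))].
by case=> [j|//]; apply/ord_succ_le; exact: H.
Qed.

Lemma ord_le_add2l a b c : ord_le b c -> ord_le (ord_add a b) (ord_add a c).
Proof.
elim: b c => B g ih c /ord_leP bc; apply/ord_add_le; split=> [|j].
  by case: c {bc} => C h; exact: (@ord_le_sup _ _ None).
have [k /ih bck] := bc j; apply: (ord_le_lt_trans bck) => {bck}.
case: c k {bc} => C h /= k; apply/ord_succ_le.
exact: (@ord_le_sup _ (fun o : option C =>
  if o is Some j then ord_succ (ord_add a (h j)) else a) (Some k)).
Qed.

Lemma ord_lt_add2l a b c : ord_lt b c -> ord_lt (ord_add a b) (ord_add a c).
Proof.
move=> [k bck]; apply: (ord_le_lt_trans (ord_le_add2l a bck)).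
case: c k {bck} => C h /= k; apply/ord_succ_le.
exact: (@ord_le_sup _ (fun o : option C =>
  if o is Some j then ord_succ (ord_add a (h j)) else a) (Some k)).
Qed.

Lemma ord_le_addr a b : ord_le a (ord_add a b).
Proof. by case: b => B g; exact: (@ord_le_sup _ _ None). Qed.

(* The usual recursive clauses for ordinal addition. *)
Lemma ord_add0 a : ord_eq (ord_add a ord_zero) a.
Proof.
split; last exact: ord_le_addr.
by apply/ord_add_le; split=> [|[]]; exact: ord_le_refl.
Qed.

Lemma ord_addS a b : ord_eq (ord_add a (ord_succ b)) (ord_succ (ord_add a b)).
Proof.
split; last first.
  by apply/ord_succ_le/ord_lt_add2l/ord_succ_le; exact: ord_le_refl.
apply/ord_add_le; split=> [|j]; last first.
  by apply/ord_succ_le; exact: ord_le_refl.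
apply: ord_lt_le; apply: (ord_le_lt_trans (ord_le_addr a b)).
by apply/ord_succ_le; exact: ord_le_refl.
Qed.

Lemma ord_add_sup a (A : Type) (f : A -> Ord) : inhabited A ->
  ord_eq (ord_add a (ord_sup f)) (ord_sup (fun i => ord_add a (f i))).
Proof.
move=> [i0]; split; last first.
  by apply/ord_sup_le => i; exact/ord_le_add2l/ord_le_sup.
apply/ord_add_le; split=> [|p].
  exact: ord_le_trans (ord_le_addr a (f i0))
    (ord_le_sup (fun i => ord_add a (f i)) i0).
apply: ord_lt_le_trans (ord_le_sup (fun i => ord_add a (f i)) (projT1 p)).
apply: ord_lt_add2l; exact: (@ord_child_lt (f (projT1 p)) (projT2 p)).
Qed.

Definition wf_poset (d : Order.disp_t) (P : porderType d) : Prop :=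
  well_founded (fun x y : P => (x < y)%O).

Definition rk (d : Order.disp_t) (P : porderType d) (wfP : wf_poset P) :
    P -> Ord :=
  Fix wfP (fun _ => Ord) (fun x rec =>
    ord_sup (fun x' : {x' : P | (x' < x)%O} =>
      ord_succ (rec (sval x') (svalP x')))).

Definition ordinal_rank (d : Order.disp_t) (P : porderType d)
    (wfP : wf_poset P) : Ord :=
  ord_sup (fun x : P => ord_succ (rk wfP x)).

Lemma rkE (d : Order.disp_t) (P : porderType d) (wfP : wf_poset P) (x : P) :
  rk wfP x =
  ord_sup (fun x' : {x' : P | (x' < x)%O} => ord_succ (rk wfP (sval x'))).
Proof.
rewrite {1}/rk Fix_eq // => y F G FG; congr ord_sup.
by apply: funext => z; rewrite FG.
Qed.

(* [cover_compact] is compactness in terms of open covers; unlike [compact_cover],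
   nothing here requires the space to be nonempty. *)
Definition noetherian (X : topologicalType) : Prop :=
  forall U : set X, open U -> cover_compact U.

(* H_0 X: the closed subsets, ordered by inclusion (see [hoare0_leE]). *)
Definition hoare0 (X : topologicalType) : Type :=
  {A : set X | `[< closed A >]}.

HB.instance Definition _ (X : topologicalType) := SubChoice.on (hoare0 X).
HB.instance Definition _ (X : topologicalType) :=
  [SubChoice_isSubPOrder of hoare0 X by <: with set_display].

Lemma hoare0_leE (X : topologicalType) (A B : hoare0 X) :
  (A <= B)%O = (val A `<=` val B) :> Prop.
Proof. by rewrite -subsetEset. Qed.

Lemma hoare0_ltE (X : topologicalType) (A B : hoare0 X) :
  (A < B)%O = (val A `<` val B) :> Prop.
Proof. by rewrite -properEset. Qed.

Lemma hoare0_wf (X : topologicalType) : noetherian X -> wf_poset (hoare0 X).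
Proof.
move=> nX C; apply: contrapT => nC.
pose lt (A B : hoare0 X) := (A < B)%O : Prop.
have step (A : {A : hoare0 X | ~ Acc lt A}) :
    {B : {A : hoare0 X | ~ Acc lt A} | (sval B < sval A)%O}.
  apply: cid; apply: contrapT; case: A => A nA H; apply: (nA).
  constructor => B BA; apply: contrapT => nB.
  by apply: H; exists (exist _ B nB).
pose u := fix u n := if n is m.+1 then sval (step (u m)) else exist _ C nC.
have uS n : (sval (u n.+1) < sval (u n))%O by exact: svalP (step (u n)).
have u_le m n : m <= n -> (sval (u n) <= sval (u m))%O.
  elim: n => [|n ih]; first by rewrite leqn0 => /eqP ->.
  rewrite leq_eqVlt => /orP[/eqP -> //|/ih]; apply: le_trans; exact: ltW.
pose U n := ~` val (sval (u n)).
have openU n : open (U n).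
  by apply: closed_openC; case: (sval (u n)) => A cA; exact/asboolP.
have [D _ DU] := nX _ (bigcup_open (fun i (_ : setT i) => openU i)) nat setT U
  (fun i _ => openU i) (@subset_refl _ _).
pose N := \max_(i <- enum_fset D) i.
have := uS N; rewrite lt_def => /andP[/eqP ne le]; apply: ne; apply: le_anti.
rewrite le; apply/andP; split => //; apply/asboolP => x uNx.
apply: contrapT => nx; have [|i iD] := DU x; first by exists N.+1.
apply; have /u_le := @leq_bigmax_seq _ _ xpredT (fun j : nat => j) i iD isT.
by rewrite hoare0_leE; apply.
Qed.

(* ||X|| = |H_0 X| - 1. *)
Definition stature (X : topologicalType) (nX : noetherian X) : Ord :=
  ord_pred (ordinal_rank (hoare0_wf nX)).

Definition hoare0T (X : topologicalType) : hoare0 X :=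
  exist _ setT (introT (asboolP _) (@closedT X)).

Lemma rk_le (d : Order.disp_t) (P : porderType d) (wfP : wf_poset P) (x y : P) :
  (x <= y)%O -> ord_le (rk wfP x) (rk wfP y).
Proof.
move=> xy; rewrite rkE; apply/ord_sup_le => -[z zx] /=.
rewrite (rkE _ y); have zy := lt_le_trans zx xy.
exact: (@ord_le_sup {x' : P | (x' < y)%O}
  (fun x' => ord_succ (rk wfP (sval x'))) (exist _ z zy)).
Qed.

Lemma ordinal_rank_hoare0 (X : topologicalType) (nX : noetherian X) :
  ord_eq (ordinal_rank (hoare0_wf nX))
         (ord_succ (rk (hoare0_wf nX) (hoare0T X))).
Proof.
split.
  apply/ord_sup_le => A; apply/ord_succ_le; exists tt; apply: rk_le.
  by rewrite hoare0_leE.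
exact: (@ord_le_sup _ (fun A => ord_succ (rk (hoare0_wf nX) A)) (hoare0T X)).
Qed.

Lemma ord_pred_le a b : ord_le a b -> ord_le (ord_pred a) (ord_pred b).
Proof.
move=> /ord_leP ab; apply/ord_sup_le => i; have [j] := ab i.
move=> /ord_le_trans; apply; exact: (@ord_le_sup _ (@ord_child b) j).
Qed.

Lemma stature_rk (X : topologicalType) (nX : noetherian X) :
  ord_eq (stature nX) (rk (hoare0_wf nX) (hoare0T X)).
Proof.
have [le1 le2] := ordinal_rank_hoare0 nX.
have [le3 le4] := ord_pred_succ (rk (hoare0_wf nX) (hoare0T X)).
split; first exact: ord_le_trans (ord_pred_le le1) le3.
exact: ord_le_trans le4 (ord_pred_le le2).
Qed.

Definition lexsum (X Y : topologicalType) : Type := (X + Y)%type.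

Definition lexsum_open (X Y : topologicalType) (W : set (X + Y)) : Prop :=
  (exists2 V : set Y, open V & W = inr @` V) \/
  (exists2 U : set X, open U & W = inl @` U `|` range inr).

Lemma lexsum_openT (X Y : topologicalType) : @lexsum_open X Y setT.
Proof.
right; exists setT; first exact: openT.
by rewrite eqEsubset; split=> // -[x|y] _; [left; exists x|right; exists y].
Qed.

Lemma lexsum_openI (X Y : topologicalType) : setI_closed (@lexsum_open X Y).
Proof.
move=> A B [[V oV ->]|[U oU ->]] [[V' oV' ->]|[U' oU' ->]].
- left; exists (V `&` V'); first exact: openI.
  rewrite eqEsubset; split=> z.
    by move=> [[v Vv <-] [v' V'v [vv]]]; exists v => //; split=> //; rewrite -vv.
  by move=> [v [Vv V'v] <-]; split; exists v.
- left; exists V => //; rewrite eqEsubset; split=> z; first by case.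
  by move=> [v Vv <-]; split; [exists v|right; exists v].
- left; exists V' => //; rewrite eqEsubset; split=> z; first by case.
  by move=> [v Vv <-]; split; [right; exists v|exists v].
- right; exists (U `&` U'); first exact: openI.
  rewrite eqEsubset; split=> -[x|y].
  + move=> [[[u Uu [<-]]|[? ? //]] [[u' Uu' [uu']]|[? ? //]]].
    by left; exists u => //; split=> //; rewrite -uu'.
  + by move=> _; right; exists y.
  + by move=> [[u [Uu Uu'] [<-]]|[? ? //]]; split; left; exists u.
  + by move=> _; split; right; exists y.
Qed.

Lemma lexsum_open_inl (X Y : topologicalType) (W : set (X + Y)) :
  lexsum_open W -> open (inl @^-1` W).
Proof.
case=> [[V oV ->]|[U oU ->]].
  rewrite (_ : _ @^-1` _ = set0); first exact: open0.
  by rewrite eqEsubset; split=> x // [].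
rewrite (_ : _ @^-1` _ = U) //.
rewrite eqEsubset; split=> x; first by move=> [[u Uu [<-]]|[]].
by move=> Ux; left; exists x.
Qed.

Lemma lexsum_open_inr (X Y : topologicalType) (W : set (X + Y)) :
  lexsum_open W -> open (inr @^-1` W).
Proof.
case=> [[V oV ->]|[U oU ->]].
  rewrite (_ : _ @^-1` _ = V) //.
  by rewrite eqEsubset; split=> y; [move=> [v Vv [<-]]|exists y].
rewrite (_ : _ @^-1` _ = setT); first exact: openT.
by rewrite eqEsubset; split=> y // _; right; exists y.
Qed.

Lemma lexsum_open_bigU (X Y : topologicalType) (I : Type)
    (f : I -> set (X + Y)) :
  (forall i, lexsum_open (f i)) -> lexsum_open (\bigcup_i f i).
Proof.
move=> of_.
have oX i : open (inl @^-1` f i) by exact: lexsum_open_inl.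
have oY i : open (inr @^-1` f i) by exact: lexsum_open_inr.
have [[i [U oU fE]]|noU] :=
    pselect (exists i, exists2 U : set X, open U & f i = inl @` U `|` range inr).
  right; exists (\bigcup_i inl @^-1` f i); first exact: bigcup_open.
  rewrite eqEsubset; split=> -[x|y].
  - by move=> [j _ fjx]; left; exists x => //; exists j.
  - by move=> _; right; exists y.
  - by move=> [[x' [j _ fjx'] [<-]]|[? ? //]]; exists j.
  - by move=> _; exists i => //; rewrite fE; right; exists y.
left; exists (\bigcup_i inr @^-1` f i); first exact: bigcup_open.
rewrite eqEsubset; split=> -[x|y].
- move=> [j _ fjx]; have [[V oV fE]|oU] := of_ j; last by case: noU; exists j.
  by move: fjx; rewrite fE => -[].
- by move=> [j _ fjy]; exists y => //; exists j.
- by move=> [].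
- by move=> [y' [j _ fjy'] [<-]]; exists j.
Qed.

HB.instance Definition _ (X Y : topologicalType) :=
  Choice.copy (lexsum X Y) (X + Y)%type.
HB.instance Definition _ (X Y : topologicalType) :=
  isOpenTopological.Build (lexsum X Y) (@lexsum_openT X Y) (@lexsum_openI X Y)
    (@lexsum_open_bigU X Y).

Lemma open_lexsumE (X Y : topologicalType) :
  @open (lexsum X Y) = @lexsum_open X Y.
Proof. by []. Qed.

Lemma lexsum_noetherian (X Y : topologicalType) :
  noetherian X -> noetherian Y -> noetherian (lexsum X Y).
Proof.
move=> nX nY W oW I D f of_ Wf.
have [|x /Wf|DX DXD DXf] := nX _ (lexsum_open_inl oW) I D (fun i => inl @^-1` f i).
- by move=> i /of_ /lexsum_open_inl.
- by [].
have [|y /Wf|DY DYD DYf] := nY _ (lexsum_open_inr oW) I D (fun i => inr @^-1` f i).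
- by move=> i /of_ /lexsum_open_inr.
- by [].
exists (DX `|` DY)%fset => [i|[x|y]].
- by rewrite in_fsetU => /orP[/DXD|/DYD].
- by move=> /DXf[i iD fi]; exists i => //=; rewrite in_fsetU; apply/orP; left.
- by move=> /DYf[i iD fi]; exists i => //=; rewrite in_fsetU; apply/orP; right.
Qed.

(* Main.v *)
Require Import Defs.
From mathcomp Require Import all_boot all_order.
From mathcomp Require Import boolp classical_sets.
From mathcomp Require Import topology.

(** The closed subsets of the lexicographic sum of [X] and [Y] are the closed
    subsets [A] of [X] and the sets [X + B] with [B] closed in [Y]: an open set
    meeting [X] contains all of [Y], so a closed set meeting [Y] contains all
    of [X].  Every [A] lies below every [X + B], so the poset of closed sets is
    that of [X] with that of [Y] stacked on top, the greatest element [X] of the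
    former being glued to the least element [X + set0] of the latter.  Ranks in
    the lower part are unchanged, and those in the upper part are shifted by
    the rank of the gluing point ([rk_stack]): the rank of [X + B] is the rank
    of [X] plus that of [B].  Taking [B] to be all of [Y] gives the claim,
    because the stature is the rank of the whole space ([stature_rk]). *)

Set Implicit Arguments.
Unset Strict Implicit.
Unset Printing Implicit Defensive.

Import Order.TTheory.
Local Open Scope classical_set_scope.

(** * Ordinal addition and equality *)

Lemma ord_le_add2r a b c : ord_le a b -> ord_le (ord_add a c) (ord_add b c).
Proof.
move=> ab; elim: c => C h ih; apply/ord_add_le; split=> [|k].
  exact: ord_le_trans ab (ord_le_addr _ _).
apply: ord_le_lt_trans (ih k) _; apply: ord_lt_add2l.
exact: (@ord_child_lt (Olim h) k).
Qed.

Lemma ord_eq_sym a b : ord_eq a b -> ord_eq b a.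
Proof. by case. Qed.

Lemma ord_eq_trans b a c : ord_eq a b -> ord_eq b c -> ord_eq a c.
Proof.
move=> [ab ba] [bc cb].
by split; [exact: ord_le_trans bc|exact: ord_le_trans ba].
Qed.

Lemma ord_eq_add a a' b b' :
  ord_eq a a' -> ord_eq b b' -> ord_eq (ord_add a b) (ord_add a' b').
Proof.
move=> [aa' a'a] [bb' b'b]; split.
  exact: ord_le_trans (ord_le_add2r _ aa') (ord_le_add2l _ bb').
exact: ord_le_trans (ord_le_add2r _ a'a) (ord_le_add2l _ b'b).
Qed.

(** * Ranks in stacked posets *)

Lemma rk_lt (d : Order.disp_t) (P : porderType d) (wfP : wf_poset P) (x y : P) :
  (x < y)%O -> ord_lt (rk wfP x) (rk wfP y).
Proof.
move=> xy; apply/ord_succ_le; rewrite (rkE _ y).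
exact: (@ord_le_sup {x' : P | (x' < y)%O}
  (fun x' => ord_succ (rk wfP (sval x'))) (exist _ x xy)).
Qed.

Lemma rk_leP (d : Order.disp_t) (P : porderType d) (wfP : wf_poset P) (x : P)
    (a : Ord) :
  ord_le (rk wfP x) a <-> forall x', (x' < x)%O -> ord_lt (rk wfP x') a.
Proof.
rewrite rkE ord_sup_le; split=> [H x' x'x|H [x' x'x]].
  exact/ord_succ_le/(H (exist _ x' x'x)).
exact/ord_succ_le/H.
Qed.

Lemma rk_homo (d d' : Order.disp_t) (P : porderType d) (Q : porderType d')
    (wfP : wf_poset P) (wfQ : wf_poset Q) (f : P -> Q) :
  {homo f : x y / (x < y)%O} -> forall x, ord_le (rk wfP x) (rk wfQ (f x)).
Proof.
move=> f_lt; elim/(well_founded_ind wfP) => x ih; apply/rk_leP => x' x'x.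
exact: ord_le_lt_trans (ih _ x'x) (rk_lt _ (f_lt _ _ x'x)).
Qed.

Lemma rk_initial (d d' : Order.disp_t) (P : porderType d) (Q : porderType d')
    (wfP : wf_poset P) (wfQ : wf_poset Q) (f : P -> Q) :
  (forall x y, (y < f x)%O -> exists2 x', (x' < x)%O & y = f x') ->
  forall x, ord_le (rk wfQ (f x)) (rk wfP x).
Proof.
move=> f_down; elim/(well_founded_ind wfP) => x ih; apply/rk_leP => y.
by move=> /f_down[x' x'x ->]; exact: ord_le_lt_trans (ih _ x'x) (rk_lt _ x'x).
Qed.

(** Here [i] embeds [P] as an initial segment of [R], and [j] stacks [Q] above
    [i t].  An element of [R] strictly below [j q] is either the image of some
    [p < t], of rank less than that of [t], or some [j q'] with [q' < q];
    hence the rank of [j q] obeys the recursion that defines ordinal addition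
    with left summand the rank of [t].  The case [r = i t] is counted
    on the side of [j]: were it allowed among the [p], the rank of [j q] could
    exceed that of [t] already for [q] minimal. *)
Lemma rk_stack (dP dQ dR : Order.disp_t) (P : porderType dP)
    (Q : porderType dQ) (R : porderType dR) (wfP : wf_poset P)
    (wfQ : wf_poset Q) (wfR : wf_poset R) (i : P -> R) (j : Q -> R) (t : P) :
  {homo i : p p' / (p < p')%O} ->
  (forall p r, (r < i p)%O -> exists2 p', (p' < p)%O & r = i p') ->
  {homo j : q q' / (q < q')%O} ->
  (forall q, i t <= j q)%O ->
  (forall q r, (r < j q)%O ->
     (exists2 p, (p < t)%O & r = i p) \/ (exists2 q', (q' < q)%O & r = j q')) ->
  forall q, ord_eq (rk wfR (j q)) (ord_add (rk wfP t) (rk wfQ q)).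
Proof.
move=> i_lt i_down j_lt ij j_down; elim/(well_founded_ind wfQ) => q ih; split.
  apply/rk_leP => r /j_down[[p pt ->]|[q' q'q ->]].
    apply: ord_lt_le_trans (ord_le_addr _ _).
    exact: ord_le_lt_trans (rk_initial wfP wfR i_down p) (rk_lt _ pt).
  exact: ord_le_lt_trans (ih _ q'q).1 (ord_lt_add2l _ (rk_lt _ q'q)).
apply/ord_add_le; split.
  exact: ord_le_trans (rk_homo wfP wfR i_lt t) (rk_le _ (ij q)).
(* a child of [rk q] is the rank of some [q' < q] *)
rewrite rkE => -[[q' q'q] []] /=.
exact: ord_le_lt_trans (ih _ q'q).2 (rk_lt _ (j_lt _ _ q'q)).
Qed.

(** * Closed subsets of a lexicographic sum *)

Definition hoare0_of (X : topologicalType) (A : set X) (cA : closed A) :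
    hoare0 X :=
  exist _ A (introT (asboolP _) cA).

Lemma hoare0_closed (X : topologicalType) (A : hoare0 X) : closed (val A).
Proof. by case: A => A /= /asboolP. Qed.
Arguments hoare0_closed {X} A.

Section ClosedLexsum.
Variables X Y : topologicalType.
Implicit Types D : set (lexsum X Y).

Lemma closed_lexsum_inl (A : set X) :
  closed A -> closed (inl @` A : set (lexsum X Y)).
Proof.
move=> cA; rewrite -openC open_lexsumE; right; exists (~` A).
  exact: closed_openC.
rewrite eqEsubset; split=> -[x|y].
- by move=> nAx; left; exists x => // Ax; apply: nAx; exists x.
- by move=> _; right; exists y.
- by move=> [[x' nAx' [<-]] [x'' Ax'' [xx]]|[]//]; apply: nAx'; rewrite -xx.
- by move=> _ [].
Qed.

Lemma closed_lexsum_inr (B : set Y) :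
  closed B -> closed (range inl `|` inr @` B : set (lexsum X Y)).
Proof.
move=> cB; rewrite -openC open_lexsumE; left; exists (~` B).
  exact: closed_openC.
rewrite eqEsubset; split=> -[x|y].
- by case; left; exists x.
- by move=> nBy; exists y => // By; apply: nBy; right; exists y.
- by case.
- by move=> [y' nBy' [<-]] [[]//|[y'' By'' [yy]]]; apply: nBy'; rewrite -yy.
Qed.

Lemma closed_preimage_inl D : closed D -> closed (inl @^-1` D : set X).
Proof.
move=> /closed_openC; rewrite open_lexsumE => /lexsum_open_inl.
by rewrite preimage_setC openC.
Qed.

Lemma closed_preimage_inr D : closed D -> closed (inr @^-1` D : set Y).
Proof.
move=> /closed_openC; rewrite open_lexsumE => /lexsum_open_inr.
by rewrite preimage_setC openC.
Qed.

(** The complement of [D] is open and misses a point of [Y], so it does not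
    contain [Y] and must be an open subset of [Y]. *)
Lemma closed_lexsum_inlT D (y : Y) :
  closed D -> D (inr y) -> forall x, D (inl x).
Proof.
move=> /closed_openC; rewrite open_lexsumE => -[[V _ DE]|[U _ DE]] Dy x.
  apply: contrapT => nDx.
  have : (~` D) (inl x) by [].
  by rewrite DE => -[].
suff : (~` D) (inr y) by [].
by rewrite DE; right; exists y.
Qed.

Definition hoare0_inl (A : hoare0 X) : hoare0 (lexsum X Y) :=
  hoare0_of (closed_lexsum_inl (hoare0_closed A)).

Definition hoare0_inr (B : hoare0 Y) : hoare0 (lexsum X Y) :=
  hoare0_of (closed_lexsum_inr (hoare0_closed B)).

Definition hoare0_preinl (D : hoare0 (lexsum X Y)) : hoare0 X :=
  hoare0_of (closed_preimage_inl (hoare0_closed D)).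

Definition hoare0_preinr (D : hoare0 (lexsum X Y)) : hoare0 Y :=
  hoare0_of (closed_preimage_inr (hoare0_closed D)).

Lemma hoare0_inl_le : {mono hoare0_inl : A A' / (A <= A')%O}.
Proof.
move=> A A'; apply/idP/idP; rewrite !hoare0_leE /= => AA'.
  by move=> x Ax; have [|x' A'x' [<-]] := AA' (inl x); first by exists x.
by move=> _ [x /AA' A'x <-]; exists x.
Qed.

Lemma hoare0_inr_le : {mono hoare0_inr : B B' / (B <= B')%O}.
Proof.
move=> B B'; apply/idP/idP; rewrite !hoare0_leE /= => BB'.
  move=> y By; have [|[]//|[y' B'y' [<-]]//] := BB' (inr y).
  by right; exists y.
by move=> _ [[x _ <-]|[y /BB' B'y <-]]; [left; exists x|right; exists y].
Qed.

Lemma hoare0_inl_inr A B : (hoare0_inl A <= hoare0_inr B)%O.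
Proof. by rewrite hoare0_leE => _ [x _ <-]; left; exists x. Qed.

Lemma hoare0_preinlK (D : hoare0 (lexsum X Y)) : (forall y, ~ val D (inr y)) ->
  hoare0_inl (hoare0_preinl D) = D.
Proof.
move=> nDY; apply: val_inj; rewrite /= eqEsubset; split=> [_ [x Dx <-]//|].
by move=> [x Dx|y /nDY//]; exists x.
Qed.

Lemma hoare0_preinrK (D : hoare0 (lexsum X Y)) : (forall x, val D (inl x)) ->
  hoare0_inr (hoare0_preinr D) = D.
Proof.
move=> DX; apply: val_inj; rewrite /= eqEsubset.
split=> [_ [[x _ <-]|[y Dy <-]]//|].
  exact: DX.
by move=> [x _|y Dy]; [left; exists x|right; exists y].
Qed.

(** If [D] contains [X] then [D] is [X + B]; otherwise [D] misses [Y], and it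
    is a closed subset of [X] distinct from [X]. *)
Lemma hoare0_lexsumP (D : hoare0 (lexsum X Y)) :
  (exists2 A, (A < hoare0T X)%O & D = hoare0_inl A) \/
  (exists B, D = hoare0_inr B).
Proof.
have [DX|nDX] := pselect (forall x, val D (inl x)).
  by right; exists (hoare0_preinr D); rewrite hoare0_preinrK.
left; exists (hoare0_preinl D).
  rewrite hoare0_ltE; split=> // DX; apply: nDX => x; exact: (DX x I).
rewrite hoare0_preinlK // => y Dy; apply: nDX.
exact: closed_lexsum_inlT (hoare0_closed D) Dy.
Qed.

Lemma hoare0_inl_down A (D : hoare0 (lexsum X Y)) :
  (D < hoare0_inl A)%O ->
  exists2 A', (A' < A)%O & D = hoare0_inl A'.
Proof.
move=> DA; have E : D = hoare0_inl (hoare0_preinl D).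
  rewrite hoare0_preinlK // => y Dy.
  by move: (ltW DA); rewrite hoare0_leE => /(_ _ Dy)[].
by exists (hoare0_preinl D); rewrite // -(leW_mono hoare0_inl_le) -E.
Qed.

End ClosedLexsum.

Theorem proposition9p2 (X Y : topologicalType)
    (nX : noetherian X) (nY : noetherian Y) :
  ord_eq (stature (lexsum_noetherian nX nY))
         (ord_add (stature nX) (stature nY)).
Proof.
apply: ord_eq_trans (stature_rk _) _.
apply: ord_eq_trans (ord_eq_sym (ord_eq_add (stature_rk nX) (stature_rk nY))).
have -> : hoare0T (lexsum X Y) = hoare0_inr X (hoare0T Y).
  apply: val_inj; rewrite /= eqEsubset; split=> // -[x|y] _.
    by left; exists x.
  by right; exists y.
apply: (rk_stack _ _ _ (i := @hoare0_inl X Y)).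
- by move=> A A'; rewrite (leW_mono (@hoare0_inl_le X Y)).
- exact: hoare0_inl_down.
- by move=> B B'; rewrite (leW_mono (@hoare0_inr_le X Y)).
- exact: hoare0_inl_inr.
- move=> B D DB; have [|[B' DE]] := hoare0_lexsumP D; first by left.
  by right; exists B'; rewrite // -(leW_mono (@hoare0_inr_le X Y)) -DE.
Qed.
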